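(* Let $(G,u)$ and $(H,v)$ be nearly divisible dimension groups with order unit, with faithful traces $\sigma$ of $G$ and $\tau$ of $H$, such that: (i) for all nonzero order ideals $I$ of $G$, $\sigma(I)=\sigma(G)$, and for all nonzero order ideals $J$ of $H$, $\tau(J)=\tau(H)$; (ii) $\sigma\otimes 1_{\mathbb Q}$ is a good trace on $G\otimes\mathbb Q$ and $\tau\otimes 1_{\mathbb Q}$ is a good trace on $H\otimes\mathbb Q$. Then $\sigma\otimes\tau$ is a good trace of $G\otimes H$.
   Context: A dimension group is a directed unperforated partially ordered abelian group with Riesz interpolation; $u\in G^+$ is an order unit if for every $g\in G$ there is a positive integer $K$ with $-Ku\le g\le Ku$. An order ideal is a convex directed subgroup; it has its own order unit $w$ if $w\in I$ is an order unit of $I$ in the relative ordering. A trace is a nonzero positive group homomorphism $\tau:G\to\mathbb R$; it is faithful if $\ker\tau\cap G^+=\{0\}$, and good if for every $b\in G^+$ and $a'\in G$ with $0\le\tau(a')\le\tau(b)$ there is $a\in G$ with $0\le a\le b$ and $\tau(a)=\tau(a')$. $S(G,u)$ is the compact convex set of traces with $\tau(u)=1$, $\mathrm{Aff}\,S(G,u)$ the Banach space of continuous affine real functions on it. $(G,u)$ is approximately divisible if the image of $G$ under $g\mapsto\hat g$, $\hat g(\tau)=\tau(g)$, is norm-dense in $\mathrm{Aff}\,S(G,u)$. $G$ is nearly divisible if every order ideal $(I,w)$ of $G$ with its own order unit is approximately divisible. Tensor products are over $\mathbb Z$; $G\otimes H$ has positive cone $\{\sum g_i\otimes h_i:g_i\in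 G^+,h_i\in H^+\}$ (finite sums); $G\otimes\mathbb Q$ is ordered in the same way, $\sigma\otimes1_{\mathbb Q}$ sends $g\otimes q$ to $q\sigma(g)$, and $(\sigma\otimes\tau)(g\otimes h)=\sigma(g)\tau(h)$. *)

(* Defs.v *)
From HB Require Import structures.
From mathcomp Require Import all_boot all_order all_algebra generic_quotient.
From mathcomp Require Import all_classical all_reals all_analysis.

Set Implicit Arguments.
Unset Strict Implicit.
Unset Printing Implicit Defensive.
Import Order.TTheory GRing.Theory Num.Theory numFieldNormedType.Exports.
Local Open Scope classical_set_scope.
Local Open Scope quotient_scope.
Local Open Scope ring_scope.

(* An abelian group with a translation-invariant preorder, given by its positive
   cone. Antisymmetry is not part of the structure (it is required in
   [dimension_group]), so that every tensor product carries the structure. *)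
HB.mixin Record isPreorderedZmodule G of GRing.Zmodule G := {
  poscone : set G;
  poscone0 : poscone 0;
  posconeD : forall x y, poscone x -> poscone y -> poscone (x + y)
}.

#[short(type="preorderedZmodType")]
HB.structure Definition PreorderedZmodule :=
  { G of GRing.Zmodule G & isPreorderedZmodule G }.

Definition cone_le (G : preorderedZmodType) (x y : G) : Prop := poscone (y - x).

Notation "x <=+ y" := (cone_le x y) (at level 70, no associativity).

Section DimensionGroups.
Variable G : preorderedZmodType.
Implicit Types (x y u : G) (I : set G).

Definition antisymmetric_order := forall x y, x <=+ y -> y <=+ x -> x = y.

Definition directed I :=
  forall x y, I x -> I y -> exists z, [/\ I z, x <=+ z & y <=+ z].

Definition unperforated :=
  forall x (n : nat), (0 < n)%N -> 0 <=+ x *+ n -> 0 <=+ x.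

Definition riesz_interpolation :=
  forall x1 x2 y1 y2,
    x1 <=+ y1 -> x1 <=+ y2 -> x2 <=+ y1 -> x2 <=+ y2 ->
    exists z, [/\ x1 <=+ z, x2 <=+ z, z <=+ y1 & z <=+ y2].

Definition dimension_group :=
  [/\ antisymmetric_order, directed setT, unperforated & riesz_interpolation].

Definition order_unit u :=
  0 <=+ u /\
  forall x, exists2 K : nat, (0 < K)%N & - (u *+ K) <=+ x /\ x <=+ u *+ K.

Definition convex_subset I :=
  forall x y z, I x -> I z -> x <=+ y -> y <=+ z -> I y.

Definition order_ideal I :=
  [/\ zmod_closed [pred x | x \in I], convex_subset I & directed I].

End DimensionGroups.

Definition ideal_mem (G : preorderedZmodType) (I : set G) (_ : order_ideal I) :
  {pred G} := fun x => x \in I.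

Section IdealType.
Variables (G : preorderedZmodType) (I : set G) (hI : order_ideal I).

Fact ideal_mem_closed : zmod_closed (ideal_mem hI).
Proof. by case: hI. Qed.

HB.instance Definition _ :=
  GRing.isZmodClosed.Build G (ideal_mem hI) ideal_mem_closed.

Record ideal_type := IdealType {
  ideal_val :> G; ideal_valP : ideal_val \in ideal_mem hI }.

HB.instance Definition _ := [isSub for ideal_val].
HB.instance Definition _ := [Choice of ideal_type by <:].
HB.instance Definition _ := [SubChoice_isSubZmodule of ideal_type by <:].

Let ideal_cone : set ideal_type := [set x | poscone (\val x)].

Fact ideal_cone0 : ideal_cone 0.
Proof. by rewrite /ideal_cone /mkset raddf0; exact: poscone0. Qed.

Fact ideal_coneD x y : ideal_cone x -> ideal_cone y -> ideal_cone (x + y).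
Proof. by rewrite /ideal_cone /mkset raddfD; exact: posconeD. Qed.

HB.instance Definition _ :=
  isPreorderedZmodule.Build ideal_type ideal_cone0 ideal_coneD.

End IdealType.

Section Traces.
Variable R : realType.

Definition is_trace (G : preorderedZmodType) (t : G -> R) :=
  [/\ zmod_morphism t, forall g, 0 <=+ g -> 0 <= t g & exists g, t g != 0].

Definition faithful_trace (G : preorderedZmodType) (t : G -> R) :=
  is_trace t /\ forall g, 0 <=+ g -> t g = 0 -> g = 0.

Definition good_trace (G : preorderedZmodType) (t : G -> R) :=
  is_trace t /\
  forall b a' : G, 0 <=+ b -> 0 <= t a' <= t b ->
    exists a, [/\ 0 <=+ a, a <=+ b & t a = t a'].

(* S(G, u), with the topology of pointwise convergence *)
Definition trace_space (G : preorderedZmodType) (u : G) : set {ptws G -> R} :=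
  [set t | is_trace t /\ t u = 1].

(* Aff S(G, u); only the values of [f] on [trace_space u] matter. *)
Definition continuous_affine (G : preorderedZmodType) (u : G)
    (f : {ptws G -> R} -> R) :=
  {within trace_space u, continuous f} /\
  forall s t (l : R), trace_space u s -> trace_space u t -> 0 <= l <= 1 ->
    f (fun g => l * s g + (1 - l) * t g) = l * f s + (1 - l) * f t.

(* Density for the supremum norm over S(G, u), which is compact. *)
Definition approximately_divisible (G : preorderedZmodType) (u : G) :=
  forall f, continuous_affine u f -> forall e : R, 0 < e ->
    exists g : G, forall t, trace_space u t -> `|f t - t g| < e.

Definition nearly_divisible (G : preorderedZmodType) :=
  forall (I : set G) (hI : order_ideal I) (w : ideal_type hI),
    order_unit w -> approximately_divisible w.

End Traces.

(* The tensor product over Z: finite formal sums of pairs (lists), modulo the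
   congruence generated by commutativity and the bilinear relations. This monoid
   is already a group, with - (g, h) = (- g, h). *)
Section TensorProduct.
Variables G H : zmodType.

Inductive tensor_rel : seq (G * H) -> seq (G * H) -> Prop :=
| tensor_refl s : tensor_rel s s
| tensor_sym s t : tensor_rel s t -> tensor_rel t s
| tensor_trans s t r : tensor_rel s t -> tensor_rel t r -> tensor_rel s r
| tensor_cat s s' t t' :
    tensor_rel s s' -> tensor_rel t t' -> tensor_rel (s ++ t) (s' ++ t')
| tensor_comm s t : tensor_rel (s ++ t) (t ++ s)
| tensor_0l h : tensor_rel [:: (0, h)] [::]
| tensor_Dl g g' h : tensor_rel [:: (g + g', h)] [:: (g, h); (g', h)]
| tensor_Dr g h h' : tensor_rel [:: (g, h + h')] [:: (g, h); (g, h')].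

Let teq : rel (seq (G * H)) := fun s t => `[< tensor_rel s t >].

Fact teq_equiv : equiv_class_of teq.
Proof.
split=> [s|s t|t s r]; first by apply/asboolP; exact: tensor_refl.
  by apply/asboolP/asboolP; exact: tensor_sym.
by move=> /asboolP st /asboolP tr; apply/asboolP; exact: tensor_trans st tr.
Qed.

Canonical teq_equiv_rel := EquivRelPack teq_equiv.

Definition tensor := {eq_quot teq}.

HB.instance Definition _ := EqQuotient.on tensor.
HB.instance Definition _ := Choice.on tensor.

Lemma tensor_piP (s t : seq (G * H)) :
  tensor_rel s t <-> \pi_tensor s = \pi_tensor t.
Proof.
split=> [st|/eqmodP/asboolP//].
by apply/eqmodP/asboolP.
Qed.

Lemma tensor_repr (s : seq (G * H)) : tensor_rel (repr (\pi_tensor s)) s.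
Proof. by apply/tensor_piP; rewrite reprK. Qed.

Let tadd (x y : tensor) : tensor := \pi_tensor (repr x ++ repr y).
Let topp (x : tensor) : tensor := \pi_tensor [seq (- p.1, p.2) | p <- repr x].

Let taddE s t : tadd (\pi_tensor s) (\pi_tensor t) = \pi_tensor (s ++ t).
Proof. by apply/tensor_piP; apply: tensor_cat; exact: tensor_repr. Qed.

Let taddA : associative tadd.
Proof.
move=> x y z; rewrite -[x]reprK -[y]reprK -[z]reprK.
by rewrite (taddE (repr x) (repr y)) (taddE (repr y) (repr z)) !taddE catA.
Qed.

Let taddC : commutative tadd.
Proof.
move=> x y; rewrite -[x]reprK -[y]reprK !taddE.
by apply/tensor_piP; exact: tensor_comm.
Qed.

Let tadd0 : left_id (\pi_tensor [::]) tadd.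
Proof. by move=> x; rewrite -[x]reprK taddE. Qed.

Let taddN : left_inverse (\pi_tensor [::]) topp tadd.
Proof.
move=> x; rewrite -[x in tadd _ x]reprK /topp taddE; apply/tensor_piP.
elim: (repr x) => [|[g h] s ih] /=; first exact: tensor_refl.
set s' := map _ s in ih *.
apply: (@tensor_trans _ ([:: (- g, h); (g, h)] ++ (s' ++ s))).
  rewrite -cat1s -[(_, h) :: s]cat1s -[[:: _; _]]/([:: (- g, h)] ++ [:: (g, h)]).
  rewrite -!catA; apply: tensor_cat; first exact: tensor_refl.
  by rewrite !catA; apply: tensor_cat; [exact: tensor_comm|exact: tensor_refl].
rewrite -[[::]]/([::] ++ [::]); apply: tensor_cat ih.
apply: tensor_trans (tensor_0l h); apply: tensor_sym.
by rewrite -{1}(addNr g); exact: tensor_Dl.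
Qed.

HB.instance Definition _ :=
  GRing.isZmodule.Build tensor taddA taddC tadd0 taddN.

Definition tens (g : G) (h : H) : tensor := \pi_tensor [:: (g, h)].

Lemma tensor_piE s : \pi_tensor s = \sum_(p <- s) tens p.1 p.2.
Proof.
elim: s => [|[g h] s ih]; first by rewrite big_nil.
by rewrite big_cons -ih -cat1s; exact/esym/taddE.
Qed.

Lemma tensor_sum (x : tensor) :
  exists s : seq (G * H), x = \sum_(p <- s) tens p.1 p.2.
Proof. by exists (repr x); rewrite -tensor_piE reprK. Qed.

Definition biadditive (A : zmodType) (f : G -> H -> A) :=
  (forall h, zmod_morphism (f^~ h)) /\ (forall g, zmod_morphism (f g)).

Lemma tens_biadditive : biadditive tens.
Proof.
have Dl g g' h : tens (g + g') h = tens g h + tens g' h.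
  by rewrite [RHS]taddE; apply/tensor_piP; exact: tensor_Dl.
have Dr g h h' : tens g (h + h') = tens g h + tens g h'.
  by rewrite [RHS]taddE; apply/tensor_piP; exact: tensor_Dr.
split=> [h g g'|g h h']; apply/eqP; rewrite -subr_eq opprK.
  by rewrite -Dl subrK.
by rewrite -Dr subrK.
Qed.

(* The map out of the tensor product induced by [f]; meaningful when [f] is
   biadditive, see [tensor_liftE] and [tensor_lift_zmod_morphism]. *)
Definition tensor_lift (A : zmodType) (f : G -> H -> A) (x : tensor) : A :=
  \sum_(p <- repr x) f p.1 p.2.

Section Lift.
Variables (A : zmodType) (f : G -> H -> A).
Hypothesis fB : biadditive f.

Lemma tensor_lift_pi s : tensor_lift f (\pi_tensor s) = \sum_(p <- s) f p.1 p.2.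
Proof.
rewrite /tensor_lift; move: (repr _) (tensor_repr s) => r.
case: fB => fl fr.
have f0 h : f 0 h = 0 by have := fl h 0 0; rewrite /= !subrr.
have Dl g g' h : f (g + g') h = f g h + f g' h.
  by have := fl h (g + g') g'; rewrite /= addrK => /esym/eqP; rewrite subr_eq => /eqP.
have Dr g h h' : f g (h + h') = f g h + f g h'.
  by have := fr g (h + h') h'; rewrite /= addrK => /esym/eqP; rewrite subr_eq => /eqP.
elim=> {r s} //.
- by move=> s t r _ -> _ ->.
- by move=> s s' t t' _ es _ et; rewrite !big_cat /= es et.
- by move=> s t; rewrite !big_cat /= addrC.
- by move=> h; rewrite big_seq1 big_nil f0.
- by move=> g g' h; rewrite !big_cons !big_nil !addr0 Dl.
- by move=> g h h'; rewrite !big_cons !big_nil !addr0 Dr.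
Qed.

Lemma tensor_liftE g h : tensor_lift f (tens g h) = f g h.
Proof. by rewrite tensor_lift_pi big_seq1. Qed.

Lemma tensor_lift_zmod_morphism : zmod_morphism (tensor_lift f).
Proof.
have D x y : tensor_lift f (x + y) = tensor_lift f x + tensor_lift f y.
  by rewrite [LHS]tensor_lift_pi big_cat.
by move=> x y; apply/eqP; rewrite eq_sym subr_eq -D subrK.
Qed.

End Lift.

End TensorProduct.

Section TensorOrder.
Variables G H : preorderedZmodType.

Let tensor_cone : set (tensor G H) :=
  [set x | exists s : seq (G * H),
     (forall p, p \in s -> 0 <=+ p.1 /\ 0 <=+ p.2) /\
     x = \sum_(p <- s) tens p.1 p.2].

Fact tensor_cone0 : tensor_cone 0.
Proof. by exists [::]; rewrite big_nil. Qed.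

Fact tensor_coneD x y : tensor_cone x -> tensor_cone y -> tensor_cone (x + y).
Proof.
move=> [s [ps ->]] [t [pt ->]]; exists (s ++ t); rewrite big_cat; split=> // p.
by rewrite mem_cat => /orP[/ps|/pt].
Qed.

HB.instance Definition _ :=
  isPreorderedZmodule.Build (tensor G H) tensor_cone0 tensor_coneD.

End TensorOrder.

Fact rat_cone0 : [set q : rat | 0 <= q] 0.
Proof. exact: lexx. Qed.

Fact rat_coneD (p q : rat) :
  [set q : rat | 0 <= q] p -> [set q : rat | 0 <= q] q ->
  [set q : rat | 0 <= q] (p + q).
Proof. exact: addr_ge0. Qed.

HB.instance Definition _ := isPreorderedZmodule.Build rat rat_cone0 rat_coneD.

Definition tensor_trace (R : realType) (G H : zmodType) (s : G -> R) (t : H -> R) :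
    tensor G H -> R :=
  tensor_lift (fun g h => s g * t h).

Definition trace_rat (R : realType) (G : zmodType) (s : G -> R) :
    tensor G rat -> R :=
  tensor_lift (fun g q => ratr q * s g).

Lemma tensor_trace_tens (R : realType) (G H : zmodType) (s : G -> R) (t : H -> R)
    g h :
  zmod_morphism s -> zmod_morphism t ->
  tensor_trace s t (tens g h) = s g * t h.
Proof.
move=> sM tM; rewrite [LHS]tensor_liftE //; split=> [h'|g'] x y.
  by rewrite sM mulrBl.
by rewrite tM mulrBr.
Qed.

Lemma trace_rat_tens (R : realType) (G : zmodType) (s : G -> R) g q :
  zmod_morphism s -> trace_rat s (tens g q) = ratr q * s g.
Proof.
move=> sM; rewrite [LHS]tensor_liftE //; split=> [p|g'] x y.
  by rewrite sM mulrBr.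
by rewrite rmorphB mulrBl.
Qed.

(* Main.v *)
(* Let T = sigma (x) tau. Cutting the prescribed value t = T(a') along the
   summands of b reduces to b = g (x) h and 0 < t < T(b), and by (i) t is then
   T of a sum of tensors x (x) y with x, y in the order ideals generated by g, h.
   Fix small order units e, f of these ideals. Goodness of sigma over Q writes a
   multiple n (x - i e) as p + k with 0 <= p <= n e and sigma(k) = 0, and
   approximate divisibility gives h' with n h' close to y. Then
   x (x) y - k (x) h' has the same trace as x (x) y and is close to
   i e (x) y; exchanging the factors, it can be moved close to an integral
   multiple of e (x) f. So t is the trace of some m (e (x) f) + error, which for
   fine e, f lies between 0 and g (x) h. All comparisons are explicit sums of
   positive tensors, so that unperforation of G (x) H is not needed. *)

Require Import Defs.
From HB Require Import structures.
From mathcomp Require Import all_boot all_order all_algebra.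
From mathcomp Require Import ring lra zify.
From mathcomp Require Import all_classical all_reals all_analysis.

Set Implicit Arguments.
Unset Strict Implicit.
Unset Printing Implicit Defensive.
Import Order.TTheory GRing.Theory Num.Theory numFieldNormedType.Exports.
Local Open Scope classical_set_scope.
Local Open Scope ring_scope.

(** * Deciding identities in abelian groups *)

(* Every abelian group embeds in its square-zero extension of the integers, a
   commutative ring in which [ring] decides the identities of the group. *)
Section SquareZeroExtension.
Variable V : zmodType.

Definition sqzero := (int * V)%type.
HB.instance Definition _ := GRing.Zmodule.on sqzero.

Let one : sqzero := (1, 0).
Let mul (a b : sqzero) : sqzero := (a.1 * b.1, b.2 *~ a.1 + a.2 *~ b.1).

Fact sqzero_mulA : associative mul.
Proof.
move=> [a x] [b y] [c z]; rewrite /mul /=; congr pair; first by rewrite mulrA.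
by rewrite !mulrzDl -!mulrzA addrA [b * a]mulrC [c * a]mulrC.
Qed.

Fact sqzero_mulC : commutative mul.
Proof. by move=> [a x] [b y]; rewrite /mul /= mulrC addrC. Qed.

Fact sqzero_mul1 : left_id one mul.
Proof. by move=> [a x]; rewrite /mul /= mul1r mulr1z mul0rz addr0. Qed.

Fact sqzero_mulD : left_distributive mul +%R.
Proof.
move=> [a x] [b y] [c z]; congr pair; rewrite /= ?mulrDl //.
by rewrite mulrzDr mulrzDl addrACA.
Qed.

HB.instance Definition _ := GRing.Zmodule_isComPzRing.Build sqzero
  sqzero_mulA sqzero_mulC sqzero_mul1 sqzero_mulD.

Definition sqzero_in (x : V) : sqzero := (0, x).

Fact sqzero_in_zmod_morphism : zmod_morphism sqzero_in.
Proof. by move=> x y; congr pair; rewrite /= subrr. Qed.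

HB.instance Definition _ :=
  GRing.isZmodMorphism.Build V sqzero sqzero_in sqzero_in_zmod_morphism.

Lemma sqzero_in_inj : injective sqzero_in.
Proof. by move=> x y []. Qed.

End SquareZeroExtension.

Ltac zmod_ring := apply: sqzero_in_inj; ring.

(** * Arithmetic of the preorder *)

Section Order.
Variable K : preorderedZmodType.
Implicit Types x y z : K.

(** The shape of nearly every comparison below: a sum of known inequalities is exhibited, and
    [zmod_ring] checks that its difference is the required one. *)
Lemma cone_leP x y a b : a <=+ b -> b - a = y - x -> x <=+ y.
Proof. by rewrite /cone_le => ? <-. Qed.

Lemma cone_le_refl x : x <=+ x.
Proof. by rewrite /cone_le subrr; exact: poscone0. Qed.

Lemma cone_leD x y z t : x <=+ y -> z <=+ t -> x + z <=+ y + t.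
Proof. by move=> xy zt; rewrite /cone_le opprD addrACA; exact: posconeD. Qed.

Lemma cone_le_trans y x z : x <=+ y -> y <=+ z -> x <=+ z.
Proof. by move=> xy yz; apply: cone_leP (cone_leD xy yz) _; zmod_ring. Qed.

Lemma cone_leMn n x y : x <=+ y -> x *+ n <=+ y *+ n.
Proof.
move=> xy; elim: n => [|n ih]; first exact: cone_le_refl.
by rewrite !mulrSr; exact: cone_leD.
Qed.

Lemma cone_leN x y : x <=+ y -> - y <=+ - x.
Proof. by move=> xy; apply: cone_leP xy _; zmod_ring. Qed.

Lemma cone_le_weak n m x : 0 <=+ x -> (n <= m)%N -> x *+ n <=+ x *+ m.
Proof.
by move=> x0 /subnK <-; apply: cone_leP (cone_leMn (m - n) x0) _; zmod_ring.
Qed.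

Lemma cone_leMn_inv n x y :
  unperforated K -> (0 < n)%N -> x *+ n <=+ y *+ n -> x <=+ y.
Proof.
move=> unp n0 xy; have: 0 <=+ y - x.
  by apply: (unp _ n n0); apply: cone_leP xy _; zmod_ring.
by move=> h; apply: cone_leP h _; zmod_ring.
Qed.

End Order.

(** * Existence of states *)

(* If [x] is not positive, a cone that contains [- x] and the positive cone and
   is maximal among those avoiding the negative multiples of [w] is total, hence
   defines a state. *)
Section StateExtension.
Variables (R : realType) (K : preorderedZmodType) (w x : K).
Hypotheses (unp : unperforated K) (unitw : order_unit w) (xN : ~ 0 <=+ x).

Let base : set K := [set y | exists k, 0 <=+ y + x *+ k].

Let proper_cone (P : set K) := [/\ base `<=` P,
  forall y z, P y -> P z -> P (y + z) & forall m, ~ P (- (w *+ m.+1))].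

Let base_proper : proper_cone base.
Proof.
split=> // [y z [k yk] [l zl]|m [k mk]].
  by exists (k + l)%N; apply: cone_leP (cone_leD yk zl) _; zmod_ring.
case: unitw => w0 wK.
have {}mk : w *+ m.+1 <=+ x *+ k by apply: cone_leP mk _; zmod_ring.
(* For [k > 0], unperforation makes [x] positive. For [k = 0], [w] is below 0, and then every
   element, being above some [- (w *+ n)], is positive. *)
have [k0|k_gt0] := posnP k; last first.
  apply: xN; apply: (unp k_gt0); apply: cone_le_trans mk.
  by apply: cone_leP (cone_leMn m.+1 w0) _; zmod_ring.
have wN : w <=+ 0.
  by apply: (cone_leMn_inv unp (ltn0Sn m)); rewrite mul0rn; rewrite k0 mulr0n in mk.
have [n _ [xn _]] := wK x; apply: xN; apply: cone_le_trans xn.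
by apply: cone_leP (cone_leMn n wN) _; zmod_ring.
Qed.

Let total_cone : exists P, proper_cone P /\ forall y, P y \/ P (- y).
Proof.
have [|A [[A0|Apr] Amax]] := @Zorn_bigcup K [set A | A = set0 \/ proper_cone A].
- move=> F FP Ftot.
  have [[X FX Xpr]|noX] := pselect (exists2 X, F X & proper_cone X); last first.
    left; rewrite -subset0 => y [X FX Xy].
    have [X0|Xpr] := FP _ FX; first by rewrite X0 in Xy.
    by exfalso; apply: noX; exists X.
  right; split.
  + by move=> y by_; exists X => //; case: Xpr => /(_ _ by_).
  + move=> y z [Y FY Yy] [Z FZ Zz].
    wlog YZ : y z Y Z FY FZ Yy Zz / Y `<=` Z.
      move=> wl; have [YZ|ZY] := Ftot _ _ FY FZ; first exact: (wl y z Y Z).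
      by rewrite addrC; apply: (wl z y Z Y).
    exists Z => //; have [Z0|[_ ZD _]] := FP _ FZ; first by rewrite Z0 in Zz.
    by apply: ZD => //; exact: YZ.
  + move=> m [Y FY Ym]; have [Y0|[_ _ /(_ m)]] := FP _ FY; last exact.
    by rewrite Y0 in Ym.
- exfalso; apply: (Amax base); last by right.
  rewrite A0; split => //; rewrite subset0; apply/eqP/set0P; exists 0, 0%N.
  by rewrite mulr0n addr0; exact: cone_le_refl.
exists A; split=> // y; case: (Apr) => bA AD Am.
have A0 : A 0 by apply: bA; exists 0%N; rewrite mulr0n addr0; exact: cone_le_refl.
have AMn n z : A z -> A (z *+ n).
  by move=> Az; elim: n => [|n ih]; rewrite ?mulr0n // mulrSr; exact: AD.
(* By maximality, the cone generated by [A] and a new [z] contains a negative multiple of [w], in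
   which [z] really occurs. *)
have ext z : ~ A z -> exists k p m, A p /\ - (w *+ m.+1) = p + z *+ k.+1.
  move=> nAz; apply: contrapT => none.
  apply: (Amax [set t | exists k p, A p /\ t = p + z *+ k]).
    split=> [t At|]; first by exists 0%N, t; rewrite mulr0n addr0.
    by move=> /(_ z) h; apply: nAz; apply: h; exists 1%N, 0; rewrite add0r.
  right; split.
  - by move=> t /bA At; exists 0%N, t; rewrite mulr0n addr0.
  - move=> _ _ [k [p [Ap ->]]] [l [q [Aq ->]]]; exists (k + l)%N, (p + q).
    by split; [exact: AD|zmod_ring].
  - move=> m [[|k] [p [Ap e]]]; last by apply: none; exists k, p, m.
    by apply: (Am m); rewrite e mulr0n addr0.
apply: contrapT => /not_orP[/ext [k [p [m [Ap e]]]] /ext [l [q [n [Aq f]]]]].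
(* Multiplying the two relations by [l.+1] and [k.+1] and adding eliminates [y], which leaves a
   negative multiple of [w] in [A]. *)
apply: (Am (m.+1 * l + m + n.+1 * k + n).+1).
suff -> : - (w *+ (m.+1 * l + m + n.+1 * k + n).+2) = p *+ l.+1 + q *+ k.+1.
  by apply: AD; exact: AMn.
transitivity (- (w *+ m.+1) *+ l.+1 + - (w *+ n.+1) *+ k.+1).
  by zmod_ring.
by rewrite e f; zmod_ring.
Qed.

Lemma state_le0_exists : exists2 t : K -> R, trace_space w t & t x <= 0.
Proof.
have [P [[bP PD Pm] Ptot]] := total_cone.
have [w0 wK] := unitw.
have Pge0 y : 0 <=+ y -> P y.
  by move=> y0; apply: bP; exists 0%N; rewrite mulr0n addr0.
have PMn n y : P y -> P (y *+ n).
  move=> Py; elim: n => [|n ih]; last by rewrite mulrSr; exact: PD.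
  by rewrite mulr0n; apply: Pge0; exact: cone_le_refl.
have Pw (c : int) : P (w *~ c) -> (0 <= c)%R.
  case: c => // n; rewrite NegzE mulrNz => h; exfalso; exact: Pm h.
(* [A y] is the lower cut of the rationals [a / b] with [a w] below [b y] in the order of [P]; its
   supremum is the value of the state. *)
pose A y : set R := [set r | exists a b,
   r = a%:~R / b.+1%:R /\ P (y *+ b.+1 - w *~ a)].
pose t y := sup (A y).
have b0 (b : nat) : (0 : R) < b.+1%:R by rewrite ltr0n.
have Aub y k r : y <=+ w *+ k -> A y r -> r <= k%:R.
  move=> yk [a [b [-> Pab]]]; rewrite ler_pdivrMr //.
  have : P (w *~ ((k * b.+1)%:Z - a)).
    have /(PD _ _ Pab) : P ((w *+ k - y) *+ b.+1).
      by apply/PMn/Pge0; apply: cone_leP yk _; zmod_ring.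
    by congr (P _); zmod_ring.
  by move=> /Pw; rewrite subr_ge0 -(ler_int R) -natrM.
have Alb y k : - (w *+ k) <=+ y -> A y (- k%:R).
  move=> ky; exists (- k%:Z), 0%N; rewrite divr1 rmorphN; split => //.
  by apply: Pge0; apply: cone_leP ky _; zmod_ring.
have Asup y : has_sup (A y).
  have [k _ [ky yk]] := wK y; split; first by exists (- k%:R); exact: Alb.
  by exists k%:R => r; exact: Aub.
have le_t y r : A y r -> r <= t y.
  by move=> ?; apply: ub_le_sup => //; case: (Asup y).
have t_le y r : (forall s, A y s -> s <= r) -> t y <= r.
  by move=> h; apply: ge_sup => //; case: (Asup y).
have tD y z : t y + t z <= t (y + z).
  rewrite -lerBrDr; apply/t_le => r [a [b [er Pr]]].
  rewrite lerBrDr -lerBrDl; apply/t_le => s [c [d [es Ps]]].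
  rewrite lerBrDl; apply/le_t; exists (a * d.+1%:Z + c * b.+1%:Z), (b * d + b + d)%N.
  have -> : (b * d + b + d).+1 = (b.+1 * d.+1)%N by lia.
  split.
    rewrite er es addf_div ?gt_eqF // natrM; congr (_ / _).
    by rewrite rmorphD /= !rmorphM /=.
  have := PD _ _ (PMn d.+1 _ Pr) (PMn b.+1 _ Ps); congr (P _); zmod_ring.
(* Totality of [P] enters here: a rational strictly between [t y] and [- t (- y)] would belong to
   neither cut. With [tD], this makes [t] additive. *)
have tN y : - t y <= t (- y).
  rewrite leNgt; apply/negP => /[1!ltrNr] /rat_in_itvoo[q].
  rewrite in_itv /= => /andP[tq qt].
  have [b eb] : exists b : nat, denq q = b.+1%:Z.
    by case: (ratP q) => n b _; exists b.
  have eq : ratr q = (numq q)%:~R / b.+1%:R :> R by rewrite /ratr eb.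
  have [h|h] := Ptot (y *+ b.+1 - w *~ numq q).
    by move: tq; rewrite ltNge le_t //; exists (numq q), b.
  move: qt; rewrite ltNge lerNl le_t //; exists (- numq q), b.
  by rewrite eq rmorphN mulNr; split=> //; move: h; congr (P _); zmod_ring.
have t0 y : 0 <=+ y -> 0 <= t y.
  by move=> y0; apply/le_t; rewrite -oppr0; apply: (Alb y 0%N); rewrite mulr0n oppr0.
have tw : t w = 1.
  apply/eqP; rewrite eq_le; apply/andP; split.
    by apply/t_le => r; apply: (Aub w 1%N); exact: cone_le_refl.
  apply/le_t; exists 1, 0%N; rewrite divr1; split=> //.
  by apply: Pge0; apply: cone_leP (cone_le_refl w) _; zmod_ring.
exists t; first split=> //.
  split=> //; last by exists w; rewrite tw oner_neq0.
  move=> y z; apply/eqP; rewrite eq_le; apply/andP; split.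
    by rewrite lerBrDr -[leRHS](congr1 t (subrK z y)); exact: tD.
  by apply: le_trans (tD _ _); rewrite lerD2l.
apply/t_le => r [a [b [-> Pab]]].
rewrite pmulr_lle0 ?invr_gt0 // lerz0.
have xN1 : P (- x).
  by apply: bP; exists 1%N; rewrite mulr1n addNr; exact: cone_le_refl.
have : P (w *~ - a).
  by have := PD _ _ Pab (PMn b.+1 _ xN1); congr (P _); zmod_ring.
by move=> /Pw; rewrite oppr_ge0.
Qed.

End StateExtension.

(** * Additive maps given as plain functions *)

Section ZmodMorphism.
Variables (A B : zmodType) (f : A -> B).
Hypothesis fM : zmod_morphism f.

Let additive_f : {additive A -> B} :=
  HB.pack f (GRing.isZmodMorphism.Build A B f fM).

Lemma zmod_morphism0 : f 0 = 0. Proof. exact: (raddf0 additive_f). Qed.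

Lemma zmod_morphismN x : f (- x) = - f x.
Proof. exact: (raddfN additive_f). Qed.

Lemma zmod_morphismD x y : f (x + y) = f x + f y.
Proof. exact: (raddfD additive_f). Qed.

Lemma zmod_morphismMn n x : f (x *+ n) = f x *+ n.
Proof. exact: (raddfMn additive_f). Qed.

Lemma zmod_morphismMz n x : f (x *~ n) = f x *~ n.
Proof. exact: (raddfMz additive_f). Qed.

Lemma zmod_morphism_sum I (r : seq I) (F : I -> A) :
  f (\sum_(i <- r) F i) = \sum_(i <- r) f (F i).
Proof. exact: (raddf_sum additive_f). Qed.

End ZmodMorphism.

(** * Approximate division by integers, with order bounds *)

Section ApproximateDivision.
Variables (R : realType) (K : preorderedZmodType) (w : K).
Hypotheses (unp : unperforated K) (unitw : order_unit w).
Hypothesis adw : approximately_divisible R w.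

Lemma state_gt0_cone (x : K) :
  (forall t : K -> R, trace_space w t -> 0 < t x) -> 0 <=+ x.
Proof.
move=> tx; apply: contrapT => /(state_le0_exists R unp unitw) [t tw].
by rewrite leNgt tx.
Qed.

(** The affine function [t x / n] is approximated by some [y], and [state_gt0_cone] turns the norm
    bound into an order bound. Since [w <=+ e *+ M], the tolerance [1 / (n N M)] relative to [w]
    suffices for [e]. *)
Lemma approximate_division (e x : K) (n N : nat) :
  order_unit e -> (0 < n)%N -> (0 < N)%N ->
  exists y, - e <=+ (x - y *+ n) *+ N /\ (x - y *+ n) *+ N <=+ e.
Proof.
move=> [_ eK] n0 N0; have [M M0 [_ wM]] := eK w.
have nR : 0 < n%:R :> R by rewrite ltr0n.
have NMR : 0 < (N * M)%:R :> R by rewrite ltr0n muln_gt0 N0.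
pose f (t : {ptws K -> R}) := t x / n%:R : R.
have [||y fy] := adw _ (f := f) (e := (n%:R * (N * M)%:R)^-1).
- split.
    apply: continuous_subspaceT => t.
    have px : {for t, continuous (fun t : {ptws K -> R} => t x)}.
      exact: (@proj_continuous K (fun=> R) x t).
    exact: (continuous_comp px (@mulrr_continuous R n%:R^-1 _)).
  by move=> s t l _ _ _; rewrite /f; ring.
- by rewrite invr_gt0; exact: mulr_gt0.
have near (t : K -> R) : trace_space w t ->
    `|t ((x - y *+ n) *+ (N * M))| < 1.
  move=> tw; have := fy _ tw; case: tw => [[tM _ _] _].
  have -> : t ((x - y *+ n) *+ (N * M)) = (t x / n%:R - t y) * (n%:R * (N * M)%:R).
    rewrite zmod_morphismMn // tM zmod_morphismMn // -[LHS]mulr_natr.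
    by rewrite [RHS]mulrA [in RHS]mulrBl divfK ?lt0r_neq0 // [t y * _]mulr_natr.
  have nNM : 0 < n%:R * (N * M)%:R :> R by exact: mulr_gt0.
  by move=> fty; rewrite normrM (gtr0_norm nNM) -ltr_pdivlMr // div1r.
have bound (d : K) :
    (forall t : K -> R, trace_space w t -> `|t (d *+ (N * M))| < 1) ->
    - e <=+ d *+ N.
  move=> dt; apply: (cone_leMn_inv unp M0).
  have: 0 <=+ d *+ (N * M) + w.
    apply: state_gt0_cone => t tw; have := dt _ tw; case: tw => [[tM _ _] tw].
    by rewrite (zmod_morphismD tM) tw ltr_norml => /andP[]; rewrite -ltrBlDr add0r.
  by move=> h; apply: cone_leP (cone_leD h wM) _; zmod_ring.
exists y; split; first exact: bound.
have: - e <=+ - (x - y *+ n) *+ N.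
  apply: bound => t tw; have := near _ tw; case: (tw) => [[tM _ _] _].
  by rewrite mulNrn (zmod_morphismN tM) normrN.
by move=> h; apply: cone_leP h _; zmod_ring.
Qed.

(* Approximating [f] by [e *+ D] within [f / D.+1] gives both comparisons. *)
Lemma order_unit_split (f : K) (D : nat) :
  order_unit f -> (0 < D)%N ->
  exists2 e, order_unit e & f <=+ e *+ D.+1 /\ e *+ D.-1 <=+ f.
Proof.
move=> uf D0; have [e [le_f f_le]] :=
  approximate_division f uf D0 (ltn0Sn D).
have [f0 fK] := uf.
have feD : f <=+ e *+ D.+1.
  apply: (cone_leMn_inv unp D0).
  by apply: cone_leP f_le _; zmod_ring.
have e0 : 0 <=+ e.
  apply: (cone_leMn_inv unp (ltn0Sn D)); rewrite mul0rn.
  exact: cone_le_trans feD.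
exists e; last split=> //.
  split=> // x; have [k k0 [kx xk]] := fK x; exists (D.+1 * k)%N.
    by rewrite muln_gt0 k0.
  split.
    apply: cone_le_trans kx; apply: cone_leP (cone_leMn k feD) _; zmod_ring.
  apply: cone_le_trans xk _; apply: cone_leP (cone_leMn k feD) _; zmod_ring.
(* [(D - 1) (D + 2) = D (D + 1) - 2], and [e *+ 2] is positive. *)
apply: (cone_leMn_inv unp (ltn0Sn D.+1)).
case: D {f_le feD} D0 le_f => // D _ le_f /=.
apply: cone_leP (cone_leD le_f (cone_leMn 2 e0)) _; zmod_ring.
Qed.

End ApproximateDivision.

(** * Goodness over the rationals, with denominators cleared *)

Section RationalTensor.
Variables (R : realType) (G : preorderedZmodType).
Implicit Types s t : seq (G * rat).

(* [numq] plays the role of the partial inverse of [int -> rat]: it is used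
   only for [D] divisible by the denominators of [s]. *)
Definition clear_denominators (D : nat) (s : seq (G * rat)) : G :=
  \sum_(p <- s) p.1 *~ numq (D%:R * p.2).

Lemma denq_natM (q : rat) (k : nat) :
  (`|denq q| * k)%:R * q = (numq q * k%:Z)%:~R.
Proof.
have -> : (`|denq q| * k)%:R = (denq q)%:~R * k%:~R :> rat.
  by rewrite natrM -[`|_|%:R]/((`|_|%:Z)%:~R) absz_denq.
by rewrite rmorphM /= numqE; ring.
Qed.

(** By induction on the congruence. All multiples of [D] are allowed so that the values for two
    relations can be multiplied. Only [tensor_Dr] needs a proper [D], [numq] being additive on
    integers but not on fractions. *)
Lemma tensor_rel_clear_denominators s t : tensor_rel s t ->
  exists2 D, (0 < D)%N & forall k,
    clear_denominators (D * k) s = clear_denominators (D * k) t.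
Proof.
rewrite /clear_denominators; elim=> {s t}.
- by move=> s; exists 1%N.
- by move=> s t _ [D D0 e]; exists D.
- move=> s t r _ [D D0 e] _ [D' D'0 e']; exists (D * D')%N.
    by rewrite muln_gt0 D0.
  by move=> k; rewrite -mulnA e mulnCA e'.
- move=> s s' t t' _ [D D0 e] _ [D' D'0 e']; exists (D * D')%N.
    by rewrite muln_gt0 D0.
  by move=> k; rewrite !big_cat /= -mulnA e mulnCA e'.
- by move=> s t; exists 1%N => // k; rewrite !big_cat /= addrC.
- by move=> q; exists 1%N => // k; rewrite big_seq1 big_nil mul0rz.
- move=> g g' q; exists 1%N => // k.
  by rewrite !big_cons !big_nil /= !addr0 mulrzDl.
- move=> g q r; exists (`|denq q| * `|denq r|)%N.
    by rewrite muln_gt0 !absz_gt0 !denq_neq0.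
  move=> k; rewrite !big_cons !big_nil /= !addr0 -mulrzDr; congr (_ *~ _).
  rewrite mulrDr -mulnA denq_natM mulnCA denq_natM -rmorphD /=.
  by rewrite !numq_int.
Qed.

Lemma common_denominator s :
  exists2 D, (0 < D)%N & forall k p, p \in s ->
    (D * k)%:R * p.2 = (numq ((D * k)%:R * p.2))%:~R.
Proof.
elim: s => [|p s [D D0 ih]]; first by exists 1%N.
exists (`|denq p.2| * D)%N; first by rewrite muln_gt0 absz_gt0 denq_neq0.
move=> k r; rewrite inE => /predU1P[->|/ih].
  by rewrite -mulnA denq_natM numq_int.
by rewrite mulnAC mulnC.
Qed.

Lemma trace_rat_pi (sigma : G -> R) s : zmod_morphism sigma ->
  trace_rat sigma (\pi_(tensor G rat)%qT s) = \sum_(p <- s) ratr p.2 * sigma p.1.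
Proof.
move=> sM; rewrite [LHS]tensor_lift_pi //; split=> [q|g] x y.
  by rewrite sM mulrBr.
by rewrite rmorphB mulrBl.
Qed.

(** Goodness gives [a] such that [a] and [e (x) 1 - a] are sums [s] and [t] of positive tensors; a
    common multiple of the denominators carries both into the positive cone of [G]. *)
Lemma rational_good (sigma : G -> R) (e x : G) :
  zmod_morphism sigma -> good_trace (trace_rat sigma) ->
  0 <=+ e -> 0 <= sigma x <= sigma e ->
  exists n p, [/\ (0 < n)%N, 0 <=+ p, p <=+ e *+ n & sigma p = sigma x *+ n].
Proof.
move=> sM [_ good] e0 xe.
have [|| a [[s [sP]] + [t [tP]] +]] := good (tens e 1) (tens x 1).
- rewrite /cone_le subr0; exists [:: (e, 1)]; split; last by rewrite big_seq1.
  by move=> p; rewrite inE => /eqP->; split=> //; rewrite /cone_le subr0 /=.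
- by rewrite !trace_rat_tens // rmorph1 !mul1r.
rewrite subr0 -!tensor_piE => -> et.
rewrite trace_rat_tens // rmorph1 mul1r trace_rat_pi // => sx.
have /tensor_piP/tensor_rel_clear_denominators[D D0 De] :
    \pi_(tensor G rat)%qT (t ++ s) = \pi_(tensor G rat)%qT [:: (e, 1)].
  rewrite tensor_piE big_cat -!tensor_piE /=.
  by move/eqP: et; rewrite subr_eq eq_sym => /eqP.
have [D' D'0 Ds] := common_denominator s.
have ge0 r k : (forall p, p \in r -> 0 <=+ p.1 /\ 0 <=+ p.2) ->
    0 <=+ clear_denominators k r.
  move=> rP; rewrite /clear_denominators /cone_le subr0 big_seq.
  elim/big_ind: _ => [||p /rP[p1 p2]]; [exact: poscone0|exact: posconeD|].
  have : 0 <= numq (k%:R * p.2).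
    by rewrite numq_ge0 mulr_ge0 // -[p.2]subr0.
  case: (numq _) => // n _; rewrite -pmulrn -[_ *+ _]subr0 -[X in _ - X](mul0rn _ n).
  exact: cone_leMn.
(* [D] transports the identity of [t ++ s] with [e (x) 1] to [G]; [D'] makes the [numq] in the trace
   of [s] exact. *)
exists (D * D')%N, (clear_denominators (D * D') s); split.
- by rewrite muln_gt0 D0.
- exact: ge0.
- rewrite -[e *+ _]/(e *~ (D * D')%:Z).
  have := De D'; rewrite {2}/clear_denominators big_seq1 mulr1 /=.
  rewrite [numq _](numq_int (D * D')%:Z) => <-.
  rewrite /clear_denominators big_cat /=.
  by apply: cone_leP (ge0 _ (D * D')%N tP) _; rewrite addrK subr0.
- rewrite /clear_denominators zmod_morphism_sum // -sx -[RHS]mulr_natr mulr_suml.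
  rewrite big_seq [RHS]big_seq; apply: eq_bigr => p ps.
  rewrite zmod_morphismMz // -[LHS]mulrzr -ratr_int mulnC -(Ds D p ps).
  by rewrite rmorphM /= ratr_nat; ring.
Qed.

End RationalTensor.

(** * Traces on a single factor *)

(** To be instantiated with principal ideals. Goodness over the rationals is kept in the integral
    form of [rational_good], so that no tensor product of an ideal with the rationals has to be
    ordered. *)
Record trace_factor (R : realType) (K : preorderedZmodType) (s : K -> R) : Prop := {
  factor_trace : is_trace s;
  factor_unperforated : unperforated K;
  factor_divisible : exists2 w : K, order_unit w & approximately_divisible R w;
  factor_rational_good : forall e x : K, 0 <=+ e -> 0 <= s x <= s e ->
    exists n p, [/\ (0 < n)%N, 0 <=+ p, p <=+ e *+ n & s p = s x *+ n] }.

Lemma trace_le (R : realType) (K : preorderedZmodType) (s : K -> R) (x y : K) :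
  is_trace s -> x <=+ y -> s x <= s y.
Proof.
move=> [sM s0 _] xy; rewrite -subr_ge0 -sM; apply: s0.
by apply: cone_leP xy _; zmod_ring.
Qed.

Lemma trace_order_unit_gt0 (R : realType) (K : preorderedZmodType) (s : K -> R)
  (e : K) : is_trace s -> order_unit e -> 0 < s e.
Proof.
move=> str [e0 eK]; have [sM s0 [x sx]] := str.
rewrite lt_neqAle s0 // andbT eq_sym; apply: contraNneq sx => se.
have [k _ [kx xk]] := eK x.
move: (trace_le str kx) (trace_le str xk).
rewrite (zmod_morphismN sM) (zmod_morphismMn sM) se mul0rn oppr0 => h1 h2.
by apply/eqP/le_anti; rewrite h1 h2.
Qed.

Lemma floor_multiple (R : realType) (a b : R) :
  0 < b -> exists i : int, 0 <= a - i%:~R * b <= b.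
Proof.
move=> b0; exists (Num.floor (a / b)).
have /andP[lo /ltW hi] := real_floor_itv (num_real (a / b)).
rewrite subr_ge0 -ler_pdivlMr // lo lerBlDl; move: hi.
by rewrite rmorphD ler_pdivrMr // mulrDl mul1r addrC.
Qed.

(** * Reduction of one factor in a positive biadditive pairing *)

Section Pairing.
Variables (R : realType) (K L P : preorderedZmodType) (B : K -> L -> P).
Variables (s : K -> R) (t : L -> R) (T : P -> R).
Hypotheses (Bbi : biadditive B)
  (B0 : forall x y, 0 <=+ x -> 0 <=+ y -> 0 <=+ B x y).
Hypotheses (TM : zmod_morphism T) (TB : forall x y, T (B x y) = s x * t y).

Let Bl y : zmod_morphism (B^~ y). Proof. by case: Bbi. Qed.
Let Br x : zmod_morphism (B x). Proof. by case: Bbi. Qed.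

Lemma pairingDl x y z : B (x + y) z = B x z + B y z.
Proof. exact: (zmod_morphismD (Bl z)). Qed.
Lemma pairingNl x z : B (- x) z = - B x z.
Proof. exact: (zmod_morphismN (Bl z)). Qed.
Lemma pairingMnl n x z : B (x *+ n) z = B x z *+ n.
Proof. exact: (zmod_morphismMn (Bl z)). Qed.
Lemma pairingMzl n x z : B (x *~ n) z = B x z *~ n.
Proof. exact: (zmod_morphismMz (Bl z)). Qed.
Lemma pairingDr x y z : B x (y + z) = B x y + B x z.
Proof. exact: (zmod_morphismD (Br x)). Qed.
Lemma pairingNr x z : B x (- z) = - B x z.
Proof. exact: (zmod_morphismN (Br x)). Qed.
Lemma pairingMnr n x z : B x (z *+ n) = B x z *+ n.
Proof. exact: (zmod_morphismMn (Br x)). Qed.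
Lemma pairing0l z : B 0 z = 0.
Proof. exact: (zmod_morphism0 (Bl z)). Qed.
Lemma pairing0r x : B x 0 = 0.
Proof. exact: (zmod_morphism0 (Br x)). Qed.

Definition pairingE := (pairingDl, pairingNl, pairingMnl, pairingMzl, pairingDr,
  pairingNr, pairingMnr, pairing0l, pairing0r).

Lemma pairing_le x x' y y' : x <=+ x' -> y <=+ y' -> 0 <=+ B (x' - x) (y' - y).
Proof.
move=> xx yy; apply: B0; first by apply: cone_leP xx _; zmod_ring.
by apply: cone_leP yy _; zmod_ring.
Qed.

(** [B x d <=+ B x g <=+ B (e *+ M) g <=+ B e f], and symmetrically from below. *)
Lemma pairing_small e f g x d M :
  0 <=+ e -> 0 <=+ g -> 0 <=+ x -> x <=+ e *+ M -> g *+ M <=+ f ->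
  - g <=+ d -> d <=+ g -> - B e f <=+ B x d /\ B x d <=+ B e f.
Proof.
move=> e0 g0 x0 xM gM dlo dhi.
have h1 := cone_leD (pairing_le xM g0) (pairing_le e0 gM).
by split; [apply: cone_leP (cone_leD h1 (pairing_le x0 dlo)) _
  |apply: cone_leP (cone_leD h1 (pairing_le x0 dhi)) _];
  rewrite !pairingE; zmod_ring.
Qed.

(** Subtracting [B (x0 *+ n - p) h], whose trace is 0, replaces [x] by [e *~ i] in the first factor.
    The error [C + 3] is independent of [x]. The abstract pairing lets the lemma be applied with the
    factors exchanged. *)
Lemma pairing_reduce (e : K) (f : L) (x : K) (y : L) (C : nat) :
  trace_factor s -> trace_factor t -> order_unit e -> order_unit f ->
  f <=+ y -> y <=+ f *+ C ->
  exists z (i : int), [/\ T z = s x * t y, `|s x - i%:~R * s e| <= s e,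
    - (B e f *+ (C + 3)) <=+ z - B e y *~ i &
    z - B e y *~ i <=+ B e f *+ (C + 3)].
Proof.
move=> [str _ _ good] [ttr unpL [w uw adw] _] ue uf fy yC.
have [sM s0 _] := str; have [e0 eK] := ue.
have [i /andP[ilo ihi]] := floor_multiple (s x) (trace_order_unit_gt0 str ue).
pose x0 := x - e *~ i.
have sx0 : s x0 = s x - i%:~R * s e.
  by rewrite sM (zmod_morphismMz sM) mulrzl.
have [|n [p [n0 p0 pn sp]]] := good e x0 e0; first by rewrite sx0 ilo.
have [k k0 [kx xk]] := eK x0.
have [g ug [_ gf]] := order_unit_split unpL uw adw uf (ltn0Sn (k.*2.+1)).
have [g0 _] := ug; have [f0 _] := uf.
have [h []] := approximate_division unpL uw adw y ug n0 (ltn0Sn 0).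
rewrite !mulr1n; set d := y - h *+ n => dlo dhi.
rewrite /= in gf.
have gle m : (m <= k.*2.+1)%N -> g *+ m <=+ f.
  by move=> mk; apply: cone_le_trans gf; exact: cone_le_weak.
(* [h *+ n = y - d], which is above [f - g], hence positive. *)
have h0 : 0 <=+ h.
  apply: (cone_leMn_inv unpL n0); rewrite mul0rn.
  apply: cone_leP (cone_leD (cone_leD dhi fy) (gle 1%N _)) _ => //.
  by rewrite /d; zmod_ring.
(* [x0] may have no sign, so it is written as [(x0 + e *+ k) - e *+ k], with both terms between 0
   and [e *+ k.*2]; this explains the choice of [g]. *)
have X0 : 0 <=+ x0 + e *+ k by apply: cone_leP kx _; zmod_ring.
have Xk : x0 + e *+ k <=+ e *+ k.*2.
  by apply: cone_leP xk _; rewrite -addnn; zmod_ring.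
have [l1 l2] := pairing_small e0 g0 X0 Xk (gle _ (leqnSn _)) dlo dhi.
have ek0 : 0 <=+ e *+ k by apply: cone_leP (cone_leMn k e0) _; zmod_ring.
have [|l3 l4] := pairing_small e0 g0 ek0 (cone_le_refl _) (gle k _) dlo dhi.
  by rewrite -addnn ltnW // ltnS leq_addr.
exists (B x y - B (x0 *+ n - p) h), i; split.
- rewrite TM !TB sM sp (zmod_morphismMn sM); ring.
- by rewrite ger0_norm.
(* [B p h] is positive and at most [B e (h *+ n) <=+ B e (y + g)], which costs [C + 1]; the two
   terms of [B x0 d] cost 1 each. *)
all: have -> : B x y - B (x0 *+ n - p) h - B e y *~ i = B p h + B x0 d
       by rewrite /d /x0 !pairingE; zmod_ring.
- have l5 := cone_leD (pairing_le p0 h0) (cone_leMn C.+1 (pairing_le e0 f0)).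
  apply: cone_leP (cone_leD l5 (cone_leD l1 (cone_leN l4))) _.
  by rewrite !pairingE; zmod_ring.
- have l5 := cone_leD (pairing_le pn h0) (pairing_le e0 yC).
  have l6 := cone_leD (pairing_le e0 dlo) (pairing_le e0 (gle 1%N isT)).
  apply: cone_leP (cone_leD (cone_leD l5 l6) (cone_leD l2 (cone_leN l3))) _.
  by rewrite /d !pairingE; zmod_ring.
Qed.

End Pairing.

Lemma cone_boundMz (K : preorderedZmodType) (a b : K) (i : int) :
  - b <=+ a -> a <=+ b ->
  - (b *+ `|i|%N) <=+ a *~ i /\ a *~ i <=+ b *+ `|i|%N.
Proof.
move=> lo hi; case: i => n.
  by split; [apply: cone_leP (cone_leMn n lo) _|apply: cone_leP (cone_leMn n hi) _];
    rewrite /= -?pmulrn; zmod_ring.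
rewrite NegzE abszN /= mulrNz.
by split; [apply: cone_leP (cone_leMn n.+1 hi) _|apply: cone_leP (cone_leMn n.+1 lo) _];
  rewrite -?pmulrn; zmod_ring.
Qed.

(** * Approximation by multiples of a small product, and goodness below [B u v] *)

Section PairingApproximation.
Variables (R : realType) (K L P : preorderedZmodType) (B : K -> L -> P).
Variables (s : K -> R) (t : L -> R) (T : P -> R) (u : K) (v : L).
Hypotheses (Bbi : biadditive B)
  (B0 : forall x y, 0 <=+ x -> 0 <=+ y -> 0 <=+ B x y).
Hypotheses (TM : zmod_morphism T) (T0 : forall x, 0 <=+ x -> 0 <= T x)
  (TB : forall x y, T (B x y) = s x * t y).
Hypotheses (sF : trace_factor s) (tF : trace_factor t).
Hypotheses (uu : order_unit u) (uv : order_unit v).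

(** [A] is fixed before [D], [e] and [f]: the error grows linearly in [D], whereas in [pairing_good]
    the trace of [B u v] is of order [D ^+ 2] times that of [B e f]. *)
Definition approximable (a : P) := exists A : nat, forall D e f, (1 < D)%N ->
  order_unit e -> order_unit f ->
  u <=+ e *+ D.+1 -> v <=+ f *+ D.+1 -> f *+ D.-1 <=+ v ->
  exists z (m : int), [/\ T z = T a, - (B e f *+ (A * D)) <=+ z - B e f *~ m
    & z - B e f *~ m <=+ B e f *+ (A * D)].

Lemma approximableB a b : approximable a -> approximable b -> approximable (a - b).
Proof.
move=> [A hA] [A' hA']; exists (A + A')%N => D e f D1 ue uf uD vD fD.
have [z [m [Tz l1 l2]]] := hA D e f D1 ue uf uD vD fD.
have [z' [m' [Tz' l1' l2']]] := hA' D e f D1 ue uf uD vD fD.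
exists (z - z'), (m - m'); split; first by rewrite !TM Tz Tz'.
  by apply: cone_leP (cone_leD l1 (cone_leN l2')) _; zmod_ring.
by apply: cone_leP (cone_leD l2 (cone_leN l1')) _; zmod_ring.
Qed.

Lemma approximable_tens x y : v <=+ y -> approximable (B x y).
Proof.
move=> vy; have [_ uK] := uu; have [_ vK] := uv.
have [k _ [_ yk]] := vK y.
have [str _ _ _] := sF; have [sM _ _] := str.
have su := trace_order_unit_gt0 str uu.
pose Q := (Num.truncn (`|s x| / s u)).+1.
have sxQ : `|s x| <= Q%:R * s u.
  rewrite -ler_pdivrMr //; apply: ltW; apply: truncnS_gt.
(* The two reductions cost [k (D + 1) + 3] and [4 |i|], where [|i| <= Q (D + 1) + 1]; for [D > 1]
   the total is at most this constant times [D]. *)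
exists (2 * k + 8 * Q + 4)%N => D e f D1 ue uf uD vD fD.
have [e0 _] := ue; have [f0 _] := uf.
have fv : f <=+ v.
  apply: cone_le_trans fD; rewrite -{1}[f]mulr1n.
  by apply: cone_le_weak => //; lia.
have yC : y <=+ f *+ (k * D.+1).
  by apply: cone_le_trans yk _; apply: cone_leP (cone_leMn k vD) _; zmod_ring.
have [z [i [Tz sxi l1 l2]]] :=
  pairing_reduce Bbi B0 TM TB x sF tF ue uf (cone_le_trans fv vy) yC.
(* The same reduction with the factors exchanged moves [B e y] to a multiple of [B e f]; the
   untouched argument is [e] itself, so [C = 1] and the error is 4. *)
have [z' [j [Tz' _ l3 l4]]] : exists z (j : int), [/\ T z = t y * s e,
    `|t y - j%:~R * t f| <= t f, - (B e f *+ 4) <=+ z - B e f *~ j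
    & z - B e f *~ j <=+ B e f *+ 4].
  apply: (@pairing_reduce R L K P (fun y x => B x y) t s T _ _ TM _ f e y e 1) => //.
  - by case: Bbi.
  - by move=> y' x' ? ?; exact: B0.
  - by move=> y' x'; rewrite TB mulrC.
  - exact: cone_le_refl.
  - by rewrite mulr1n; exact: cone_le_refl.
have iQ : (`|i|%N <= Q * D.+1 + 1)%N.
  have se := trace_order_unit_gt0 str ue.
  have seu : s u <= s e * D.+1%:R.
    by have := trace_le str uD; rewrite (zmod_morphismMn sM) -[s e *+ _]mulr_natr.
  rewrite -(ler_nat R) -[`|i|%N%:R]/(`|i|%N%:~R) abszE intr_norm.
  rewrite -(ler_pM2r se) natrD natrM mulrDl mul1r.
  have -> : `|i%:~R| * s e = `|i%:~R * s e| by rewrite normrM (gtr0_norm se).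
  have := ler_normB (s x) (s x - i%:~R * s e); rewrite opprB addrC subrK => h.
  apply: le_trans h _; apply: lerD => //; apply: le_trans sxQ _.
  by rewrite -mulrA ler_wpM2l // mulrC.
have [l5 l6] := cone_boundMz i l3 l4.
have E0 : 0 <=+ B e f by exact: B0.
have cD : ((k * D.+1 + 3) + 4 * `|i|%N <= (2 * k + 8 * Q + 4) * D)%N by nia.
have Ec := cone_le_weak E0 cD.
exists (z - B e y *~ i + z' *~ i), (j * i); split.
- rewrite zmod_morphismD // TM !(zmod_morphismMz TM) Tz Tz' !TB; ring.
- by apply: cone_leP (cone_leD (cone_leD l1 l5) (cone_leN Ec)) _; zmod_ring.
- by apply: cone_leP (cone_leD (cone_leD l2 l6) Ec) _; zmod_ring.
Qed.

(** Any [y] is a difference of two elements above [v], to which [approximable_tens] applies. *)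
Lemma approximable_pairing x y : approximable (B x y).
Proof.
have [v0 vK] := uv; have [k _ [ky _]] := vK y.
have -> : B x y = B x (y + v *+ k.+1) - B x (v *+ k.+1).
  by rewrite !(pairingE Bbi); zmod_ring.
apply: approximableB; apply: approximable_tens.
  by apply: cone_leP ky _; zmod_ring.
by rewrite -{1}[v]mulr1n; exact: cone_le_weak.
Qed.

Lemma approximable_sum (r : seq (K * L)) : approximable (\sum_(p <- r) B p.1 p.2).
Proof.
elim: r => [|p r ih]; last first.
  rewrite big_cons -[B _ _]opprK addrC -pairingNl //.
  by apply: approximableB => //; exact: approximable_pairing.
by rewrite big_nil -(pairing0l Bbi v); exact: approximable_pairing.
Qed.

(** The approximant [z] lies between [m - A D] and [m + A D] times [B e f], and [B u v] is above
    [(D - 1) ^+ 2] times [B e f]. It remains to choose [D] with [A D <= m] and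
    [m + A D <= (D - 1) ^+ 2]. *)
Lemma pairing_good (r : seq (K * L)) :
  0 < T (\sum_(p <- r) B p.1 p.2) < T (B u v) ->
  exists a, [/\ 0 <=+ a, a <=+ B u v & T a = T (\sum_(p <- r) B p.1 p.2)].
Proof.
set c := \sum_(p <- r) _ => /andP[]; rewrite TB.
have [A hA] := approximable_sum r; rewrite -/c in hA.
have [str unpK [w uw adw] _] := sF; have [ttr unpL [w' uw' adw'] _] := tF.
have su := trace_order_unit_gt0 str uu; have tv := trace_order_unit_gt0 ttr uv.
set S := s u * t v; have S0 : 0 < S by exact: mulr_gt0.
move=> c0 cS.
(* With [E] the trace of [B e f], these give [2 A D E <= T c <= ((D - 1) ^+ 2 - 2 A D) E], because
   [S] lies between [E (D - 1) ^+ 2] and [E (D + 1) ^+ 2]. *)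
have [D D1 [Dlo Dhi]] : exists2 D, (1 < D)%N &
    2 * (A * D)%:R * S <= T c * D.-1%:R ^+ 2 /\
    T c * D.+1%:R ^+ 2 <= (D.-1%:R ^+ 2 - 2 * (A * D)%:R) * S.
  (* For [D = d + 1], the estimates [d + 1 <= 2 d] and [4 d + 4 <= 8 d] reduce the two conditions to
     [lo] and [hi], one for each summand of [q]. *)
  pose q := 4 * A%:R * S / T c + (8 * T c + 4 * A%:R * S) / (S - T c).
  pose d := (Num.truncn q).+1; have qd : q <= d%:R by exact/ltW/truncnS_gt.
  have Sc : 0 < S - T c by rewrite subr_gt0.
  have A0 : 0 <= 4 * A%:R * S by rewrite !mulr_ge0 // ltW.
  have d1 : 1 <= d%:R :> R by rewrite ler1n.
  have lo : 4 * A%:R * S <= T c * d%:R.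
    rewrite [leRHS]mulrC -ler_pdivrMr //; apply: le_trans qd.
    by rewrite lerDl divr_ge0 ?(ltW Sc) // addr_ge0 // mulr_ge0 // ltW.
  have hi : 8 * T c + 4 * A%:R * S <= (S - T c) * d%:R.
    rewrite [leRHS]mulrC -ler_pdivrMr //; apply: le_trans qd.
    by rewrite lerDr divr_ge0 // ltW.
  exists d.+1 => //=; rewrite natrM -[d.+2]addn2 -[d.+1]addn1 !natrD.
  have AS0 : 0 <= A%:R * S by rewrite mulr_ge0 // ltW.
  have ASd : 0 <= A%:R * S * (d%:R - 1) by rewrite mulr_ge0 // subr_ge0.
  have cd : 0 <= T c * (d%:R - 1) by rewrite mulr_ge0 ?subr_ge0 // ltW.
  have d0 : 0 <= d%:R :> R by [].
  have lod := ler_wpM2r d0 lo; have hid := ler_wpM2r d0 hi.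
  by split; lra.
have D0 : (0 < D)%N by exact: ltnW.
have [e ue [eD De]] := order_unit_split unpK uw adw uu D0.
have [f uf [fD Df]] := order_unit_split unpL uw' adw' uv D0.
have [z [m [Tz l1 l2]]] := hA D e f D1 ue uf eD fD Df.
have [sM s0 _] := str; have [tM t0 _] := ttr.
have se := trace_order_unit_gt0 str ue; have tf := trace_order_unit_gt0 ttr uf.
have [e0 _] := ue; have [f0 _] := uf; have [u0 _] := uu; have [v0 _] := uv.
have TE : T (B e f) = s e * t f by rewrite TB.
pose E := s e * t f; have E_gt0 : 0 < E by exact: mulr_gt0.
have Tle a b : a <=+ b -> T a <= T b.
  by move=> ab; rewrite -subr_ge0 -TM T0 //; apply: cone_leP ab _; zmod_ring.
have Slo : S <= E * D.+1%:R ^+ 2.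
  have := ler_pM (ltW su) (ltW tv) (trace_le str eD) (trace_le ttr fD).
  by rewrite (zmod_morphismMn sM) (zmod_morphismMn tM) -[s e *+ _]mulr_natr
    -[t f *+ _]mulr_natr mulrACA.
have Shi : E * D.-1%:R ^+ 2 <= S.
  have := ler_pM _ _ (trace_le str De) (trace_le ttr Df).
  rewrite (zmod_morphismMn sM) (zmod_morphismMn tM) -[s e *+ _]mulr_natr
    -[t f *+ _]mulr_natr mulrACA.
  by apply; rewrite mulr_ge0 // ltW.
have mlo : T c - E * (A * D)%:R <= m%:~R * E.
  have := Tle _ _ l2; rewrite TM Tz (zmod_morphismMz TM) (zmod_morphismMn TM) TE.
  by rewrite -mulrzl -[s e * t f *+ _]mulr_natr => h; rewrite lerBlDr -lerBlDl.
have mhi : m%:~R * E <= T c + E * (A * D)%:R.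
  have := Tle _ _ l1; rewrite TM Tz (zmod_morphismN TM) (zmod_morphismMz TM).
  rewrite (zmod_morphismMn TM) TE -mulrzl -[s e * t f *+ _]mulr_natr => h.
  by rewrite -/E in h; lra.
have m1 : ((A * D)%:Z <= m)%R.
  rewrite -(ler_int R) -(ler_pM2r E_gt0); apply: le_trans mlo.
  have D_gt0 : 0 < D.-1%:R ^+ 2 :> R by rewrite exprn_gt0 // ltr0n -subn1 subn_gt0.
  rewrite -(ler_pM2r D_gt0) mulrBl; apply: le_trans (lerB Dlo (lexx _)).
  have AD0 : 0 <= (A * D)%:R :> R by [].
  move: (ler_wpM2l AD0 Shi); rewrite -[_%:~R]/((A * D)%:R); lra.
have m2 : (m + (A * D)%:Z <= (D.-1 ^ 2)%N%:Z)%R.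
  rewrite -(ler_int R) rmorphD /= -(ler_pM2r E_gt0) mulrDl.
  apply: le_trans (lerD mhi (lexx _)) _.
  rewrite -[(A * D)%:~R]/((A * D)%:R) -[(D.-1 ^ 2)%N%:~R]/((D.-1 ^ 2)%N%:R) natrX.
  have D_gt0 : 0 < D.+1%:R ^+ 2 :> R by rewrite exprn_gt0 // ltr0n.
  set F := D.-1%:R ^+ 2 - 2 * (A * D)%:R in Dhi.
  have F0 : 0 <= F by rewrite -(pmulr_lge0 _ S0); apply: le_trans Dhi;
    rewrite ?mulr_ge0 ?ltW.
  have : T c <= F * E.
    rewrite -(ler_pM2r D_gt0); apply: le_trans Dhi _.
    by rewrite -mulrA ler_wpM2l.
  by rewrite /F; lra.
have E0 : 0 <=+ B e f by exact: B0.
exists z; split => //.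
  have h := cone_leMn (absz (m - (A * D)%:Z)%R) E0.
  apply: cone_leP (cone_leD l1 h) _.
  rewrite -[B e f *+ `|_|%N]/(B e f *~ `|_|%N) gez0_abs ?subr_ge0 //; zmod_ring.
have h := cone_leMn (absz ((D.-1 ^ 2)%N%:Z - m - (A * D)%:Z)%R) E0.
have h1 : 0 <=+ B u v - B e f *+ (D.-1 ^ 2).
  have f0' : 0 <=+ f *+ D.-1.
    by rewrite -[X in X <=+ _](mul0rn _ D.-1); exact: cone_leMn.
  have h1 := cone_leD (pairing_le B0 De f0') (pairing_le B0 u0 Df).
  by apply: cone_leP h1 _; rewrite !(pairingE Bbi) expnS expn1; zmod_ring.
apply: cone_leP (cone_leD (cone_leD l2 h) h1) _.
rewrite -[B e f *+ `|_|%N]/(B e f *~ `|_|%N) gez0_abs; first by zmod_ring.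
by rewrite -addrA -opprD subr_ge0.
Qed.

End PairingApproximation.

(** * The order ideal generated by a positive element *)

Section PrincipalIdeal.
Variables (G : preorderedZmodType) (g : G).
Hypothesis g0 : 0 <=+ g.

Definition principal_ideal : set G :=
  [set x | exists k : nat, - (g *+ k) <=+ x /\ x <=+ g *+ k].

Lemma principal_order_ideal : order_ideal principal_ideal.
Proof.
have widen k l x : (k <= l)%N -> - (g *+ k) <=+ x -> x <=+ g *+ k ->
    - (g *+ l) <=+ x /\ x <=+ g *+ l.
  move=> kl lo hi; have gkl := cone_le_weak g0 kl.
  by split; [exact: cone_le_trans (cone_leN gkl) lo|exact: cone_le_trans hi gkl].
split.
- split=> [|x y]; rewrite !inE.
    by exists 0%N; rewrite mulr0n oppr0; split; exact: cone_le_refl.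
  move=> [k [kx xk]] [l [ly yl]]; exists (k + l)%N; split.
    by apply: cone_leP (cone_leD kx (cone_leN yl)) _; zmod_ring.
  by apply: cone_leP (cone_leD xk (cone_leN ly)) _; zmod_ring.
- move=> x y z [k [kx xk]] [l [lz zl]] xy yz; exists (k + l)%N.
  have [lo _] := widen _ _ _ (leq_addr l k) kx xk.
  have [_ hi] := widen _ _ _ (leq_addl k l) lz zl.
  by split; [exact: cone_le_trans lo xy|exact: cone_le_trans yz hi].
- move=> x y [k [kx xk]] [l [ly yl]]; exists (g *+ (k + l)); split.
  + exists (k + l)%N; split; last exact: cone_le_refl.
    by apply: cone_leP (cone_leMn ((k + l) * 2) g0) _; zmod_ring.
  + by have [] := widen _ _ _ (leq_addr l k) kx xk.
  + by have [] := widen _ _ _ (leq_addl k l) ly yl.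
Qed.

Lemma principal_ideal_gen : g \in ideal_mem principal_order_ideal.
Proof.
rewrite /ideal_mem unfold_in /= inE; exists 1%N; rewrite mulr1n.
split; last exact: cone_le_refl.
by apply: cone_leP (cone_leMn 2 g0) _; zmod_ring.
Qed.

Local Notation I := (ideal_type principal_order_ideal).

Definition ideal_gen : I := IdealType principal_ideal_gen.

Lemma ideal_leE (x y : I) : (x <=+ y) = (\val x <=+ \val y).
Proof. by rewrite /cone_le -[poscone (y - x)]/(poscone (\val (y - x))) raddfB. Qed.

Lemma ideal_gen_order_unit : order_unit ideal_gen.
Proof.
split=> [|x]; first by rewrite ideal_leE raddf0.
have := ideal_valP x; rewrite /ideal_mem unfold_in /= inE => -[k [kx xk]].
have valMn : \val (ideal_gen *+ k.+1) = g *+ k.+1 by rewrite raddfMn.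
exists k.+1 => //; rewrite !ideal_leE raddfN [X in - X]valMn valMn.
have gk := cone_le_weak g0 (leqnSn k).
by split; [exact: cone_le_trans (cone_leN gk) kx|exact: cone_le_trans xk gk].
Qed.

(** Near divisibility is applied to the principal ideal with its generator as unit. The element [p]
    of [rational_good] stays in the ideal by convexity, as [0 <=+ p <=+ e *+ n]. *)
Lemma principal_trace_factor (R : realType) (s : G -> R) :
  unperforated G -> nearly_divisible R G -> is_trace s -> s g != 0 ->
  good_trace (trace_rat s) ->
  trace_factor (fun x : I => s (\val x)).
Proof.
move=> unp nd str sg good; have [sM s0 _] := str; split.
- split; last by exists ideal_gen.
    by move=> x y; rewrite raddfB sM.
  by move=> x; rewrite ideal_leE raddf0; exact: s0.
- by move=> x n n0; rewrite !ideal_leE raddf0 raddfMn; exact: unp.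
- exists ideal_gen; first exact: ideal_gen_order_unit.
  by apply: nd; exact: ideal_gen_order_unit.
- move=> e x; rewrite ideal_leE raddf0 => e0 xe.
  have [n [p [n0 p0 pn sp]]] := rational_good sM good e0 xe.
  have pI : p \in ideal_mem principal_order_ideal.
    have [_ convex _] := principal_order_ideal.
    rewrite /ideal_mem unfold_in /= inE; apply: (convex _ _ _ _ _ p0 pn).
      by exists 0%N; rewrite mulr0n oppr0; split; exact: cone_le_refl.
    have := ideal_valP (e *+ n); rewrite -[ideal_val _]/(\val _) raddfMn.
    by rewrite /ideal_mem unfold_in /= inE.
  by exists n, (IdealType pI); split=> //; rewrite ideal_leE ?raddf0 ?raddfMn.
Qed.

End PrincipalIdeal.

(** * The product trace *)

Section TensorTrace.
Variables (R : realType) (G H : preorderedZmodType).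
Variables (sigma : G -> R) (tau : H -> R).
Hypotheses (str : is_trace sigma) (ttr : is_trace tau).

Let sM : zmod_morphism sigma. Proof. by case: str. Qed.
Let tM : zmod_morphism tau. Proof. by case: ttr. Qed.

Lemma tensor_trace_zmod_morphism : zmod_morphism (tensor_trace sigma tau).
Proof.
apply: tensor_lift_zmod_morphism; split=> [h'|g'] x y; first by rewrite sM mulrBl.
by rewrite tM mulrBr.
Qed.

Lemma tens_ge0 (g : G) (h : H) : 0 <=+ g -> 0 <=+ h -> 0 <=+ tens g h.
Proof.
move=> g0 h0; rewrite /cone_le subr0; exists [:: (g, h)]; rewrite big_seq1.
by split=> // p; rewrite inE => /eqP->.
Qed.

Lemma tensor_trace_is_trace : is_trace (tensor_trace sigma tau).
Proof.
have TM := tensor_trace_zmod_morphism.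
have [_ s0 [g sg]] := str; have [_ t0 [h th]] := ttr; split=> //.
  move=> x; rewrite /cone_le subr0 => -[r [rP ->]].
  rewrite (zmod_morphism_sum TM) big_seq; apply: sumr_ge0 => p /rP[p1 p2].
  by rewrite tensor_trace_tens // mulr_ge0 ?s0 ?t0.
by exists (tens g h); rewrite tensor_trace_tens // mulf_neq0.
Qed.

End TensorTrace.

(** * Goodness of the product trace *)

Section GoodTensorTrace.
Variables (R : realType) (G H : preorderedZmodType).
Variables (sigma : G -> R) (tau : H -> R).
Hypotheses (unpG : unperforated G) (unpH : unperforated H).
Hypotheses (ndG : nearly_divisible R G) (ndH : nearly_divisible R H).
Hypotheses (str : is_trace sigma) (ttr : is_trace tau).
Hypotheses (sigma_ideals : forall I : set G, order_ideal I -> I <> [set 0] ->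
  sigma @` I = range sigma).
Hypotheses (tau_ideals : forall J : set H, order_ideal J -> J <> [set 0] ->
  tau @` J = range tau).
Hypotheses (sgood : good_trace (trace_rat sigma)).
Hypotheses (tgood : good_trace (trace_rat tau)).

Local Notation T := (tensor_trace sigma tau).

(** Condition (i) as a choice function into the principal ideal, which is nonzero since it contains
    [g]. The choice is not claimed to be additive. *)
Let lift_ideal (K : preorderedZmodType) (s : K -> R) (g : K) (g0 : 0 <=+ g) :
  (forall I : set K, order_ideal I -> I <> [set 0] -> s @` I = range s) ->
  g != 0 ->
  exists c : K -> ideal_type (principal_order_ideal g0),
    forall x, s (\val (c x)) = s x.
Proof.
move=> sI gN0.
suff h x : exists y : ideal_type (principal_order_ideal g0), s (\val y) = s x.
  by have [c cP] := choice h; exists c.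
have : range s (s x) by exists x.
rewrite -(sI _ (principal_order_ideal g0)) => [[y Iy <-]|I0].
  have yI : y \in ideal_mem (principal_order_ideal g0).
    by rewrite /ideal_mem unfold_in /= inE.
  by exists (IdealType yI).
have := principal_ideal_gen g0; rewrite /ideal_mem unfold_in /= inE I0 => /= g00.
by rewrite g00 eqxx in gN0.
Qed.

Lemma good_below_tens (g : G) (h : H) (a' : tensor G H) :
  0 <=+ g -> 0 <=+ h -> 0 <= T a' <= T (tens g h) ->
  exists a, [/\ 0 <=+ a, a <=+ tens g h & T a = T a'].
Proof.
move=> g0 h0 /andP[a0 ab].
have [sM _ _] := str; have [tM _ _] := ttr.
have Ttr := tensor_trace_is_trace str ttr; have [TM T0 _] := Ttr.
have Tgh : T (tens g h) = sigma g * tau h by exact: tensor_trace_tens.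
have b0 := tens_ge0 g0 h0.
(* The extreme values are attained by 0 and [tens g h]; [pairing_good] asks for strict
   inequalities. *)
have [Ta0|TaN0] := eqVneq (T a') 0.
  exists 0; split=> //; first exact: cone_le_refl.
  by rewrite (zmod_morphism0 TM).
have [Tab|TaNb] := eqVneq (T a') (T (tens g h)).
  by exists (tens g h); split=> //; exact: cone_le_refl.
have Ta_gt0 : 0 < T a' by rewrite lt_def TaN0.
have Ta_lt : T a' < T (tens g h) by rewrite lt_def eq_sym TaNb.
have : sigma g * tau h != 0 by rewrite -Tgh gt_eqF // (lt_trans Ta_gt0).
rewrite mulf_eq0 => /norP[sg th].
have gN0 : g != 0 by apply: contraNneq sg => ->; rewrite (zmod_morphism0 sM).
have hN0 : h != 0 by apply: contraNneq th => ->; rewrite (zmod_morphism0 tM).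
have [c cP] := lift_ideal g0 sigma_ideals gN0.
have [d dP] := lift_ideal h0 tau_ideals hN0.
have [r er] := tensor_sum a'.
pose B (x : ideal_type (principal_order_ideal g0))
  (y : ideal_type (principal_order_ideal h0)) : tensor G H := tens (\val x) (\val y).
(* The sum over [r'] need not equal [a'], but it has the same trace, and goodness depends on [a']
   only through [T a']. *)
pose r' := [seq (c p.1, d p.2) | p <- r].
have Tr : T (\sum_(p <- r') B p.1 p.2) = T a'.
  rewrite er !(zmod_morphism_sum TM) big_map; apply: eq_bigr => p _.
  by rewrite /B !tensor_trace_tens // cP dP.
have [tl tr] := tens_biadditive G H.
have [||||a [a_ge0 a_le Ta]] := @pairing_good R _ _ _ B (fun x => sigma (\val x))
  (fun y => tau (\val y)) T (ideal_gen g0) (ideal_gen h0) _ _ TM T0 _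
  (principal_trace_factor g0 unpG ndG str sg sgood)
  (principal_trace_factor h0 unpH ndH ttr th tgood)
  (ideal_gen_order_unit g0) (ideal_gen_order_unit h0) r'.
- by split=> [y|x] z z'; rewrite /B raddfB ?tl ?tr.
- by move=> x y; rewrite !ideal_leE !raddf0; exact: tens_ge0.
- by move=> x y; exact: tensor_trace_tens.
- by rewrite Tr Ta_gt0.
by exists a; rewrite Ta Tr.
Qed.

(* Walking greedily through the summands of [b], all but one of them are used
   entirely or not at all. *)
Lemma good_tensor_trace : good_trace T.
Proof.
have Ttr := tensor_trace_is_trace str ttr; have [TM T0 _] := Ttr.
split=> // b a'; rewrite {1}/cone_le subr0 => -[r [+ ->]]; move: a'.
elim: r => [|[g h] r ih] a' rP.
  rewrite big_nil (zmod_morphism0 TM) => a0; exists 0.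
  by rewrite (zmod_morphism0 TM) -(le_anti a0); split=> //; exact: cone_le_refl.
rewrite big_cons /= => /andP[a0 ab].
have [g0 h0] : 0 <=+ g /\ 0 <=+ h by apply: (rP (g, h)); exact: mem_head.
have {}rP p : p \in r -> 0 <=+ p.1 /\ 0 <=+ p.2.
  by move=> pr; apply: rP; rewrite inE pr orbT.
have [agh|/ltW gha] := leP (T a') (T (tens g h)).
  have [|a [a_ge0 a_le Ta]] := @good_below_tens g h a' g0 h0; first by rewrite a0.
  exists a; split=> //; apply: cone_le_trans a_le _.
  have s0 : 0 <=+ \sum_(p <- r) tens p.1 p.2.
    by rewrite /cone_le subr0; exists r.
  by apply: cone_leP s0 _; zmod_ring.
have [||a [a_ge0 a_le Ta]] := ih (a' - tens g h) => //.
  by rewrite TM subr_ge0 gha lerBlDl -(zmod_morphismD TM).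
exists (tens g h + a); split.
- by apply: cone_leP (cone_leD (tens_ge0 g0 h0) a_ge0) _; zmod_ring.
- by apply: cone_leP a_le _; zmod_ring.
- by rewrite (zmod_morphismD TM) Ta TM addrC subrK.
Qed.

End GoodTensorTrace.

Theorem proposition2p5 (R : realType) (G H : preorderedZmodType) (u : G) (v : H)
    (sigma : G -> R) (tau : H -> R)
    (dimG : dimension_group G) (dimH : dimension_group H)
    (unitu : order_unit u) (unitv : order_unit v)
    (ndG : nearly_divisible R G) (ndH : nearly_divisible R H)
    (sigma_faithful : faithful_trace sigma) (tau_faithful : faithful_trace tau)
    (sigma_ideals : forall I : set G, order_ideal I -> I <> [set 0] ->
       sigma @` I = range sigma)
    (tau_ideals : forall J : set H, order_ideal J -> J <> [set 0] ->
       tau @` J = range tau)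
    (sigma_rat_good : good_trace (trace_rat sigma))
    (tau_rat_good : good_trace (trace_rat tau)) :
  good_trace (tensor_trace sigma tau).
Proof.
move: dimG dimH sigma_faithful tau_faithful.
move=> [_ _ unpG _] [_ _ unpH _] [str _] [ttr _].
exact: good_tensor_trace.
Qed.
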